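(* Let $\Xi$ be a compact metric space and $\mu$ a Borel probability measure on $\Xi$. Assume that the functions $\Xi\ni\theta\mapsto h_N(\theta)=N^{-1}\log(m_N(\theta))$ converge uniformly on $\Xi$ to a function $h$ as $N\to\infty$. If there exists a unique $\theta^*\in\mathrm{supp}(\mu)$ such that $\arg\max_{\theta\in\Xi}h(\theta)=\theta^*$ (that is, $\theta^*$ is the unique maximizer of $h$ on $\Xi$ and $\theta^*\in\mathrm{supp}(\mu)$), with $h(\theta^* )>0$, and $\mathrm{supp}(\mu)\ne\{\theta^*\}$, then there is emerging dominance at $\{\theta^*\}$, with weight $1$.
   Context: Setting (sequence of Self-Switching Markov Chains). $\Xi$ is a compact metric space and $\mu$ a Borel probability measure on $\Xi$. $(\mathcal X_N)_{N\ge1}$ is an increasing sequence of finite sets, $x_0\in\mathcal X_1$, $T_N\subset\mathcal X_N$ with $x_0\notin T_N$, and for each $N\ge1$, $(Q_N^{(\theta)})_{\theta\in\Xi}$ is a family of irreducible stochastic matrices on $\mathcal X_N$. For $\theta\in\Xi$, $m_N(\theta)$ denotes the expected first time that the Markov chain on $\mathcal X_N$ started at $x_0$ with transition matrix $Q_N^{(\theta)}$ hits $T_N$. Standing assumption: for each $N$, the function $m_N:\Xi\to\mathbb R$ is continuous. For Borel $A\subseteq\Xi$ set $\widehat P_N(A):=\dfrac{\int_A m_N\,d\mu}{\int_\Xi m_N\,d\mu}$, a probability measure on $\Xi$. Emerging dominance: given $\{\theta_1^*,\dots,\theta_K^*\}\subsetneq\mathrm{supp}(\mu)$ (proper inclusion),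 there is emerging dominance at $\{\theta_1^*,\dots,\theta_K^*\}$ with positive weights $\{w_1,\dots,w_K\}$ if $\sum_{i=1}^K w_i=1$ and $\widehat P_N$ converges weakly, as $N\to\infty$, to $\sum_{i=1}^K w_i\delta_{\theta_i^*}$. *)

(* Defs.v *)
From HB Require Import structures.
From mathcomp Require Import all_boot all_order all_algebra finmap.
From mathcomp Require Import all_classical all_reals all_analysis measurable_realfun.

Set Implicit Arguments.
Unset Strict Implicit.
Unset Printing Implicit Defensive.

Import Order.TTheory GRing.Theory Num.Theory.
Import numFieldNormedType.Exports.

Local Open Scope classical_set_scope.
Local Open Scope ring_scope.

(* Measurable types are pointed in the library. Requiring a point of the metric
   space loses nothing: a space carrying a probability measure is nonempty. *)
#[short(type="pointedMetricType")]
HB.structure Definition PointedMetric (R : numDomainType) :=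
  {M of Pointed M & Metric R M}.

Definition borel {R : realType} (Xi : pointedMetricType R) :=
  g_sigma_algebraType (@open Xi).

(* The matrix is indexed by the ranks of the states in the finite type E. *)
Definition transition {R : realType} {E : finType} (Q : 'M[R]_#|E|) (x y : E) : R :=
  Q (enum_rank x) (enum_rank y).

Definition stochastic_matrix {R : realType} {n : nat} (Q : 'M[R]_n) : Prop :=
  (forall i j, 0 <= Q i j) /\ (forall i, \sum_j Q i j = 1).

Definition irreducible_matrix {R : realType} {n : nat} (Q : 'M[R]_n) : Prop :=
  forall i j, exists k : nat, 0 < (Q ^+ k) i j.

(* The Markov property is written in product form, so as not to divide by the
   probability of a conditioning event that may be null. *)
Definition is_markov_chain {d : measure_display} {Omega : measurableType d}
    {R : realType} {S : choiceType} {E : {fset S}} (P : probability Omega R)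
    (x0 : S) (Q : 'M[R]_#|{: E}|) (Y : nat -> Omega -> E) : Prop :=
  [/\ forall n x, measurable [set w | Y n w = x],
      P [set w | val (Y 0%N w) = x0] = 1%E
    & forall (n : nat) (s : nat -> E),
        P [set w | forall k, (k <= n.+1)%N -> Y k w = s k] =
        (P [set w | forall k, (k <= n)%N -> Y k w = s k]
          * (transition Q (s n) (s n.+1))%:E)%E].

(* The value is +oo on the trajectories that never visit T. *)
Definition hitting_time {Omega : Type} {R : realType} {S : choiceType}
    {E : {fset S}} (T : {fset S}) (Y : nat -> Omega -> E) (w : Omega) : \bar R :=
  ereal_inf [set (n%:R)%:E | n in [set n : nat | val (Y n w) \in T]].

(* The library's 'E_P only accepts real-valued functions. *)
Definition expected_hitting_time {d : measure_display}
    {Omega : measurableType d} {R : realType} {S : choiceType} {E : {fset S}}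
    (P : probability Omega R) (T : {fset S}) (Y : nat -> Omega -> E) : \bar R :=
  (\int[P]_w hitting_time T Y w)%E.

Definition supp {R : realType} {Xi : pointedMetricType R}
    (mu : probability (borel Xi) R) : set Xi :=
  [set x | forall U : set Xi, open U -> U x -> (0 < mu U)%E].

Definition argmax {R : realType} {Xi : Type} (h : Xi -> R) : set Xi :=
  [set t | forall u, h u <= h t].

Definition Phat {R : realType} {Xi : pointedMetricType R}
    (mu : probability (borel Xi) R) (m : Xi -> R) (A : set (borel Xi)) : \bar R :=
  ((\int[mu]_(t in A) (m t)%:E) / (\int[mu]_t (m t)%:E))%E.

Definition dirac_mixture {R : realType} {Xi : pointedMetricType R} {K : nat}
    (theta : 'I_K -> Xi) (w : 'I_K -> R) (A : set (borel Xi)) : \bar R :=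
  (\sum_(i < K) (w i)%:E * \d_(theta i : borel Xi) A)%E.

Lemma Phat_probability {R : realType} {Xi : pointedMetricType R}
    (mu : probability (borel Xi) R) (m : Xi -> R) :
  continuous m -> (forall x, 0 <= m x) ->
  (0 < \int[mu]_t (m t)%:E < +oo)%E ->
  exists P : probability (borel Xi) R, Phat mu m = P :> (set (borel Xi) -> \bar R).
Proof.
move=> cm m0 /andP[i0 ioo].
have mm : measurable_fun [set: borel Xi] (m : borel Xi -> R).
  apply: (measurability _ (measurable_realfun.RGenOpens.measurableE R)).
  move=> _ [_ [x [y ->]] <-]; rewrite setTI.
  apply: sub_sigma_algebra; move/continuousP: cm; apply; exact: interval_open.
have mm' := (measurable_EFinP _ _).2 mm.
have m0' : forall t : borel Xi, (0 <= (m t)%:E)%E by move=> t; rewrite lee_fin.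
have [c c0 cE] : exists2 c : R, 0 < c & (\int[mu]_t (m t)%:E = c%:E)%E.
  exists (fine (\int[mu]_t (m t)%:E)%E); first by rewrite fine_gt0 // i0.
  by rewrite fineK // ge0_fin_numE // ltW.
have PE A : Phat mu m A = (c^-1%:E * \int[mu]_(t in A) (m t)%:E)%E.
  by rewrite /Phat cE inver gt_eqF // muleC.
have P0 : Phat mu m set0 = 0%E by rewrite PE integral_set0 mule0.
have Pge0 A : (0 <= Phat mu m A)%E.
  by rewrite PE mule_ge0 ?integral_ge0 // lee_fin invr_ge0 ltW.
have Ps : semi_sigma_additive (Phat mu m).
  move=> F mF tF mUF; rewrite PE.
  under eq_fun do
    (under eq_bigr do rewrite PE; rewrite -ge0_sume_distrr;
     last by move=> *; apply: integral_ge0).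
  by apply: cvgeZl => //; apply: semi_sigma_additive_nng_induced.
have P1 : Phat mu m setT = 1%E by rewrite PE cE -EFinM mulVf ?gt_eqF.
pose I1 := isMeasure.Build _ _ _ (Phat mu m) P0 Pge0 Ps.
pose M1 : {measure set (borel Xi) -> \bar R} := HB.pack (Phat mu m) I1.
pose I2 := Measure_isProbability.Build _ _ _ M1 P1.
pose M2 : probability (borel Xi) R := HB.pack (Phat mu m) I1 I2.
by exists M2.
Qed.

Lemma dirac_mixture_probability {R : realType} {Xi : pointedMetricType R} {K : nat}
    (theta : 'I_K -> Xi) (w : 'I_K -> R) : (forall i, 0 < w i) ->
  \sum_(i < K) w i = 1 ->
  exists P : probability (borel Xi) R,
    dirac_mixture theta w = P :> (set (borel Xi) -> \bar R).
Proof.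
move=> w0 w1; set D := dirac_mixture theta w.
have P0 : D set0 = 0%E by rewrite /D /dirac_mixture big1 // => i _; rewrite measure0 mule0.
have Pt A i : (0 <= (w i)%:E * \d_(theta i : borel Xi) A :> \bar R)%E.
  by rewrite mule_ge0 // lee_fin ltW.
have Pge0 A : (0 <= D A)%E by apply: sume_ge0 => i _.
have Ps : semi_sigma_additive D.
  move=> F mF tF mUF.
  have -> : D (\bigcup_n F n) = (\sum_(0 <= n <oo) D (F n))%E.
    rewrite /D /dirac_mixture nneseries_sum //; apply: eq_bigr => i _.
    by rewrite nneseriesZl // measure_semi_bigcup.
  exact: is_cvg_nneseries.
have P1 : D setT = 1%E.
  rewrite /D /dirac_mixture; under eq_bigr do rewrite diracT mule1.
  by rewrite sumEFin w1.
pose I1 := isMeasure.Build _ _ _ D P0 Pge0 Ps.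
pose M1 : {measure set (borel Xi) -> \bar R} := HB.pack D I1.
pose I2 := Measure_isProbability.Build _ _ _ M1 P1.
pose M2 : probability (borel Xi) R := HB.pack D I1 I2.
by exists M2.
Qed.

(* Stated for bare set functions, as the library's integral is; it is used
   only for Phat and dirac_mixture, which are probability measures by
   Phat_probability and dirac_mixture_probability. *)
Definition weak_cvg {R : realType} {Xi : pointedMetricType R}
    (P : nat -> set (borel Xi) -> \bar R) (Q : set (borel Xi) -> \bar R) : Prop :=
  forall f : Xi -> R, continuous f -> (exists M : R, forall x, `|f x| <= M) ->
    (\int[P N]_x (f x)%:E)%E @[N --> \oo] --> (\int[Q]_x (f x)%:E)%E.

Definition emerging_dominance {R : realType} {Xi : pointedMetricType R} {K : nat}
    (mu : probability (borel Xi) R) (m : nat -> Xi -> R)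
    (theta : 'I_K -> Xi) (w : 'I_K -> R) : Prop :=
  [/\ injective theta,
      range theta `<` supp mu,
      forall i, 0 < w i,
      \sum_(i < K) w i = 1
    & weak_cvg (fun N => Phat mu (m N)) (dirac_mixture theta w)].

(* Main.v *)
Require Import Defs.
From HB Require Import structures.
From mathcomp Require Import all_boot all_order all_algebra finmap.
From mathcomp Require Import all_classical all_reals all_analysis.
From mathcomp Require Import measurable_realfun.
From mathcomp Require Import lra.

Set Implicit Arguments.
Unset Strict Implicit.
Unset Printing Implicit Defensive.

Import Order.TTheory GRing.Theory Num.Theory.
Import numFieldNormedType.Exports.

Local Open Scope classical_set_scope.
Local Open Scope ring_scope.

(** Each m_N is at least 1: the chain starts at x0, outside T_N, so it needs one
    step to reach T_N ([expected_hitting_time_ge1]). Hence m_N = exp(N h_N) with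
    h_N = N^-1 ln m_N continuous, and h is continuous as a uniform limit. The
    theorem is then an instance of Laplace's principle: the mass of exp(N h_N)
    gathers, as N grows, where h is largest.

    Given an open U containing theta_star, compactness yields a gap [delta]
    between the value of h at theta_star and its supremum off U ([argmax_gap]).
    For large N, uniform convergence makes m_N at most exp(N (h(theta_star) - 3
    delta / 4)) off U, and at least exp(N (h(theta_star) - delta / 2)) on a
    neighbourhood V of theta_star. As theta_star is in the support of mu, V has
    positive measure, so the mass that [Phat] gives to the complement of U is at
    most exp(- N delta / 4) / mu(V), which tends to 0 ([Phat_le],
    [Phat_concentrates]). Finally, probability measures whose mass off every
    neighbourhood of a point vanishes converge weakly to the Dirac mass at that
    point ([weak_cvg_dirac]). *)

(** * Expected hitting times are at least one *)

(** For a nonnegative [f], the integral is the supremum of the integrals of the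
    simple functions below it, and the indicator of [A] is one of them. The
    argument applies to any [f], hence to hitting times as they are defined. *)
Lemma measure_le_integral d (T : measurableType d) (R : realType)
    (mu : {measure set T -> \bar R}) (A : set T) (f : T -> \bar R) :
  measurable A -> (forall x, 0 <= f x)%E -> (forall x, A x -> 1 <= f x)%E ->
  (mu A <= \int[mu]_x f x)%E.
Proof.
move=> mA f0 f1; rewrite ge0_integralTE//; apply: ereal_sup_ubound.
exists (indic_nnsfun R mA); last by rewrite -sintegral_indic.
move=> x; change ((\1_A x)%:E <= f x)%E; rewrite indicE.
by have [/set_mem/f1//|_] := boolP (x \in A); exact: f0.
Qed.

Lemma hitting_time_ge0 (R : realType) (Omega : Type) (S : choiceType)
    (E : {fset S}) (T : {fset S}) (Y : nat -> Omega -> E) (w : Omega) :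
  (0 <= hitting_time T Y w :> \bar R)%E.
Proof. by apply: le_ereal_inf_tmp => _ [n _ <-]; rewrite lee_fin. Qed.

Lemma hitting_time_ge1 (R : realType) (Omega : Type) (S : choiceType)
    (E : {fset S}) (T : {fset S}) (Y : nat -> Omega -> E) (w : Omega) :
  val (Y 0%N w) \notin T -> (1 <= hitting_time T Y w :> \bar R)%E.
Proof.
move=> Y0; apply: le_ereal_inf_tmp => _ [n /= Yn <-]; rewrite lee_fin ler1n.
by case: n Yn => // Yn; rewrite Yn in Y0.
Qed.

Lemma expected_hitting_time_ge1 d (Omega : measurableType d) (R : realType)
    (S : choiceType) (E T : {fset S}) (P : probability Omega R) (x0 : S)
    (Q : 'M[R]_#|{: E}|) (Y : nat -> Omega -> E) :
  is_markov_chain P x0 Q Y -> x0 \notin T ->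
  (1 <= expected_hitting_time P T Y)%E.
Proof.
move=> [mY Y0 _] x0T; rewrite -Y0; apply: measure_le_integral.
- (* The event is written with the value of the state in [S]; measurability is
     known for the states, so [x0] is first lifted to [E] when it lies there. *)
  have [x0E|x0E] := boolP (x0 \in E).
    rewrite (_ : [set w | _] = [set w | Y 0%N w = [` x0E]%fset]) //.
    by apply/seteqP; split=> w /= => [Yw|->//]; exact: val_inj.
  rewrite (_ : [set w | _] = set0) // -subset0 => w /= Yw.
  by move: x0E; rewrite -Yw (valP (Y 0%N w)).
- by move=> w; exact: hitting_time_ge0.
- by move=> w /= Yw; apply: hitting_time_ge1; rewrite -Yw in x0T.
Qed.

(** * Continuous functions and Borel measures *)

Lemma continuous_borel_measurable (R : realType) (Xi : pointedMetricType R)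
    (f : Xi -> R) :
  continuous f -> measurable_fun [set: borel Xi] (f : borel Xi -> R).
Proof.
move=> cf; apply: (measurability _ (measurable_realfun.RGenOpens.measurableE R)).
move=> _ [_ [a [b ->]] <-]; rewrite setTI; apply: sub_sigma_algebra.
by move/continuousP: cf; apply; exact: interval_open.
Qed.

Lemma open_borel (R : realType) (Xi : pointedMetricType R) (U : set Xi) :
  open U -> measurable (U : set (borel Xi)).
Proof. exact: sub_sigma_algebra. Qed.

Lemma continuous_integral_lty (R : realType) (Xi : pointedMetricType R)
    (mu : probability (borel Xi) R) (f : Xi -> R) :
  compact [set: Xi] -> continuous f -> (forall x, 0 <= f x) ->
  (\int[mu]_t (f t)%:E < +oo)%E.
Proof.
move=> cXi cf f0.
have XiT : [set: Xi] !=set0 by exists point.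
have [z _ zmax] := compact_EVT_max XiT cXi (continuous_subspaceT cf).
apply: (@le_lt_trans _ _ (\int[mu]_t cst (f z)%:E t)%E).
  apply: ge0_le_integral => //.
  - by move=> t _; rewrite lee_fin.
  - by apply/measurable_EFinP; exact: continuous_borel_measurable.
  - by move=> t _; rewrite lee_fin zmax// inE.
by rewrite integral_cst// [X in (_ * X)%E]probability_setT mule1 ltry.
Qed.

(** * Weak convergence to a Dirac mass *)

(** For continuous f bounded by M and d > 0, the set U where f is d-close to f(x)
    is an open neighbourhood of x, so |f - f(x)| is at most d on U and 2 M off U.
    Integrating, |int f dp_N - f(x)| is at most d + 2 M p_N(~U). *)
Lemma weak_cvg_dirac (R : realType) (Xi : pointedMetricType R)
    (p : nat -> probability (borel Xi) R) (x : Xi) :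
  (forall U : set Xi, open U -> U x -> p N (~` U) @[N --> \oo] --> 0%E) ->
  weak_cvg (fun N => p N : set (borel Xi) -> \bar R) (\d_(x : borel Xi)).
Proof.
move=> pU f cf [M fM].
have mf := continuous_borel_measurable cf.
have M0 : 0 <= M by apply: le_trans (fM x).
have pT N : p N setT = 1%E by exact: probability_setT.
have intf N (g : borel Xi -> R) (K : R) : measurable_fun setT g ->
    (forall y, `|g y| <= K) -> (p N).-integrable setT (EFin \o g).
  move=> mg gK; apply: measurable_bounded_integrable => //.
    by rewrite [X in (X < _)%E]pT ltry.
  exists K; split; first exact: num_real.
  by move=> b Kb y _; exact: le_trans (gK y) (ltW Kb).
have intfN N : (p N).-integrable setT (EFin \o f) by exact: intf fM.
rewrite integral_dirac//; last exact/measurable_EFinP.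
rewrite diracT mul1e; apply/fine_cvgP; split.
  by apply: nearW => N; exact: (integrable_fin_num _ (intfN N)).
apply/cvgrPdist_le => e e0.
pose U := [set y | `|f x - f y| < e / 2].
have oU : open U.
  rewrite (_ : U = f @^-1` (ball (f x) (e / 2))) //.
  by move/continuousP: cf; apply; exact: ball_open.
have Ux : U x by rewrite /U /= subrr normr0 divr_gt0.
have mU : measurable (~` U : set (borel Xi)).
  by apply: measurableC; exact: open_borel.
have pU0 : ((2 * M)%:E * p N (~` U))%E @[N --> \oo] --> 0%E.
  by rewrite -(mule0 (2 * M)%:E); apply: cvgeZl => //; exact: pU.
have e2 : 0 < e / 2 by rewrite divr_gt0.
move/fine_cvgP: pU0 => [_ /cvgrPdist_le/(_ _ e2)].
apply: filterS => N; rewrite sub0r normrN => pN.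
have pfin : p N (~` U) \is a fin_num by exact: fin_num_measure.
have intI :
    (p N).-integrable setT (EFin \o (fun y => e / 2 + 2 * M * \1_(~` U) y)).
  apply: (intf _ _ (e / 2 + 2 * M)).
    by apply: measurable_funD => //; exact: measurable_funM.
  move=> y; rewrite ger0_norm ?addr_ge0 ?mulr_ge0 ?divr_ge0 ?(ltW e0)//.
  by rewrite lerD2l ler_piMr ?mulr_ge0// indicE lern1 leq_b1.
have intc : (p N).-integrable setT (EFin \o cst (f x)).
  by apply: (intf _ _ `|f x|) => //; exact: measurable_cst.
have -> : f x = fine (\int[p N]_y (f x)%:E).
  by rewrite integral_cst// [X in (_ * X)%E]pT mule1.
have finf := integrable_fin_num measurableT (intfN N).
have finc := integrable_fin_num measurableT intc.
rewrite distrC -fineB// -(integralB_EFin measurableT (intfN N) intc).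
have intfc := integrableB measurableT (intfN N) intc.
rewrite -fine_abse; last exact: (integrable_fin_num measurableT intfc).
rewrite -lee_fin fineK; last first.
  by rewrite abse_fin_num; exact: (integrable_fin_num measurableT intfc).
apply: (le_trans (le_abse_integral _ measurableT (measurable_int _ intfc))).
apply: (@le_trans _ _ (\int[p N]_y (e / 2 + 2 * M * \1_(~` U) y)%:E)%E).
  apply: ge0_le_integral => //.
  - by apply: measurableT_comp => //; exact: (measurable_int _ intfc).
  - exact: (measurable_int _ intI).
  move=> y _; rewrite -EFinB /= lee_fin indicE.
  have [|/negP] := boolP (y \in ~` U); rewrite inE /U /= => yU.
    rewrite mulr1 (le_trans (ler_normB _ _))//.
    by rewrite mulr_natl mulr2n (le_trans (lerD (fM y) (fM x)))// lerDr ltW.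
  by rewrite mulr0 addr0 distrC ltW//; apply: contrapT.
rewrite (eq_integral
  (fun y : borel Xi => (e / 2)%:E + (2 * M)%:E * (\1_(~` U) y)%:E)%E)//.
rewrite ge0_integralD//; last 3 first.
- by move=> y _; rewrite lee_fin ltW.
- by move=> y _; rewrite lee_fin mulr_ge0// mulr_ge0.
- apply/measurable_EFinP/measurable_funM => //; exact: measurable_indic.
rewrite integral_cst// [X in (_ * X + _)%E]pT mule1.
rewrite ge0_integralZl_EFin//; last 2 first.
- by apply/measurable_EFinP; exact: measurable_indic.
- by rewrite mulr_ge0.
rewrite integral_indic// setIT.
rewrite [X in (_ * X)%E](_ : _ = (fine (p N (~` U)))%:E); last first.
  by rewrite fineK.
rewrite -EFinM -EFinD lee_fin.
rewrite [leRHS]splitr lerD2l.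
move: pN; rewrite /= fineM//= ger0_norm// mulr_ge0 ?fine_ge0// mulr_ge0//.
Qed.

(** * Laplace's principle *)

(** The numerator is at most b, because mu has total mass 1, and the denominator
    is at least its part over V, hence at least a mu(V). *)
Lemma Phat_le (R : realType) (Xi : pointedMetricType R)
    (mu : probability (borel Xi) R) (m : Xi -> R) (A V : set (borel Xi))
    (a b : R) :
  measurable_fun [set: borel Xi] (m : borel Xi -> R) -> (forall x, 0 <= m x) ->
  (\int[mu]_t (m t)%:E < +oo)%E ->
  measurable A -> measurable V -> (0 < mu V)%E -> 0 < a ->
  (forall x, V x -> a <= m x) -> 0 <= b -> (forall x, A x -> m x <= b) ->
  (Phat mu m A <= (b / a * (fine (mu V))^-1)%:E)%E.
Proof.
move=> mm m0 moo mA mV V0 a0 aV b0 bA.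
have mE (D : set (borel Xi)) :
    measurable D -> measurable_fun D (fun t => (m t)%:E).
  by move=> mD; apply/measurable_EFinP; exact: measurable_funS mm.
have muV : mu V = (fine (mu V))%:E by rewrite fineK ?fin_num_measure.
have v0 : 0 < fine (mu V) by rewrite -lte_fin -muV.
have lo : ((a * fine (mu V))%:E <= \int[mu]_t (m t)%:E)%E.
  rewrite EFinM -muV -integral_cst//.
  apply: (@le_trans _ _ (\int[mu]_(t in V) (m t)%:E)%E).
    apply: ge0_le_integral => //; [by move=> x _; exact: ltW | exact: mE].
  by apply: ge0_subset_integral => //; [exact: mE | move=> x _; rewrite lee_fin].
have up : (\int[mu]_(t in A) (m t)%:E <= b%:E)%E.
  apply: (@le_trans _ _ (\int[mu]_(t in A) cst b%:E t)%E).
    by apply: ge0_le_integral => //; [move=> x _; rewrite lee_fin | exact: mE].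
  rewrite integral_cst// -[leRHS]mule1.
  by rewrite lee_wpmul2l ?lee_fin// probability_le1.
have av0 : 0 < a * fine (mu V) by rewrite mulr_gt0.
move: lo; rewrite /Phat.
have /fineK <- : (\int[mu]_t (m t)%:E)%E \is a fin_num.
  by rewrite ge0_fin_numE// integral_ge0// => x _; rewrite lee_fin.
rewrite lee_fin; set c := fine (integral _ _ _) => ac.
have c0 : 0 < c := lt_le_trans av0 ac.
rewrite inver gt_eqF// lee_pdivrMr// -EFinM (le_trans up)// lee_fin.
rewrite -mulrA -invfM -[leLHS]mulr1 -mulrA ler_wpM2l//.
by rewrite mulrC ler_pdivlMr// mul1r.
Qed.

(** The complement of U is compact, so h attains its maximum there, at a point
    that differs from the unique global maximizer. *)
Lemma argmax_gap (R : realType) (X : topologicalType) (h : X -> R) (x : X)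
    (U : set X) :
  compact [set: X] -> continuous h -> argmax h = [set x] -> open U -> U x ->
  exists2 eta, 0 < eta & forall y, ~ U y -> h y <= h x - eta.
Proof.
move=> cX ch hx oU Ux.
have xmax : argmax h x by rewrite hx.
have [U0|] := pselect (~` U !=set0); last first.
  by move=> nU; exists 1 => // y Uy; case: nU; exists y.
have cU : compact (~` U) by exact: (subclosed_compact (open_closedC oU) cX).
have [z /set_mem zU zmax] := compact_EVT_max U0 cU (continuous_subspaceT ch).
exists (h x - h z); last by move=> y Uy; rewrite subKr zmax// inE.
rewrite subr_gt0 lt_neqAle xmax andbT; apply/eqP => hzx.
have : argmax h z by move=> y; rewrite hzx; exact: xmax.
by rewrite hx => zx; move: zU; rewrite zx => /(_ Ux).
Qed.

Lemma uniform_cvg_near (R : realType) (X : choiceType) (g : nat -> X -> R)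
    (h : X -> R) (e : R) :
  {uniform, g @ \oo --> h} -> 0 < e ->
  \forall N \near \oo, forall x, `|g N x - h x| < e.
Proof.
move=> gh e0; apply: (gh [set g' : X -> R | forall x, `|g' x - h x| < e]).
apply/uniform_nbhs.
exists [set xy | ball xy.1 e xy.2]; split.
  exact: (entourage_ball _ (PosNum e0)).
by move=> g' gg' x; rewrite distrC; exact: gg' x I.
Qed.

(** With [eta] a quarter of the gap of [argmax_gap], m_N <= exp(N (h x - 3 eta))
    off U and m_N >= exp(N (h x - 2 eta)) near x for N large: one [eta] is lost to
    the approximation of h by h_N, and near x a second one to the variation of h.
    The quotient of the two bounds still decays like exp(- N eta). *)
Lemma Phat_concentrates (R : realType) (Xi : pointedMetricType R)
    (mu : probability (borel Xi) R) (m : nat -> Xi -> R) (h : Xi -> R)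
    (x : Xi) (U : set Xi) :
  compact [set: Xi] ->
  (forall N, (1 <= N)%N -> continuous (m N)) ->
  (forall N, (1 <= N)%N -> forall t, 0 < m N t) ->
  {uniform, (fun N t => N%:R^-1 * ln (m N t)) @ \oo --> h} ->
  supp mu x -> argmax h = [set x] -> open U -> U x ->
  Phat mu (m N) (~` U) @[N --> \oo] --> 0%E.
Proof.
move=> cXi mc m0 gh xsupp hx oU Ux.
have ch : continuous h.
  apply: uniform_limit_continuous gh; apply: filterS (nbhs_infty_ge 1) => N N1 t.
  apply: cvgMr; apply: continuous_cvg; last exact: mc.
  exact/continuous_ln/m0.
have [delta delta0 gap] := argmax_gap cXi ch hx oU Ux.
pose eta := delta / 4.
have deltaE : delta = 4 * eta by rewrite mulrC divfK.
have eta_gt0 : 0 < eta by rewrite divr_gt0.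
pose V := [set t | `|h x - h t| < eta].
have oV : open V.
  rewrite (_ : V = h @^-1` (ball (h x) eta)) //.
  by move/continuousP: ch; apply; exact: ball_open.
have Vx : V x by rewrite /V /= subrr normr0.
have V0 : (0 < mu V)%E := xsupp V oV Vx.
pose v := fine (mu V).
apply: (@squeeze_cvge _ _ _ _ (cst 0%E) _
  (fun N => (expR (- eta) ^+ N * v^-1)%:E)).
- near=> N.
  have N1 : (1 <= N)%N by near: N; exact: nbhs_infty_ge.
  have Nr : 0 < N%:R :> R by rewrite ltr0n.
  have gN : forall t, `|N%:R^-1 * ln (m N t) - h t| < eta.
    by near: N; exact: uniform_cvg_near gh eta_gt0.
  have lnE t : m N t = expR (N%:R * (N%:R^-1 * ln (m N t))).
    by rewrite mulVKf ?gt_eqF// lnK// posrE m0.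
  apply/andP; split.
    rewrite /Phat mule_ge0// ?inve_ge0; apply: integral_ge0 => t _;
      by rewrite lee_fin ltW// m0.
  have -> : expR (- eta) ^+ N =
      expR (N%:R * (h x - 3 * eta)) / expR (N%:R * (h x - 2 * eta)).
    by rewrite -expRB -expRM_natl; congr expR; lra.
  apply: Phat_le => //.
  - by apply: continuous_borel_measurable; exact: mc.
  - by move=> t; rewrite ltW// m0.
  - by apply: continuous_integral_lty (mc N N1) _ => // t; rewrite ltW// m0.
  - by apply: measurableC; exact: open_borel.
  - exact: open_borel.
  - exact: expR_gt0.
  - move=> t Vt; rewrite [leRHS]lnE ler_expR ler_pM2l//.
    by move: (gN t) Vt; rewrite /V /= !ltr_distl => /andP[? ?] /andP[? ?]; lra.
  - move=> t Ut; rewrite [leLHS]lnE ler_expR ler_pM2l//.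
    by move: (gN t) (gap t Ut); rewrite deltaE ltr_distl => /andP[? ?] ?; lra.
- exact: cvg_cst.
- apply: cvg_EFin; first by near=> N.
  rewrite -[X in _ --> X](mul0r v^-1).
  apply: cvgMl; apply: cvg_expr.
  by rewrite ger0_norm ?expR_ge0// expR_lt1 oppr_lt0.
Unshelve. all: by end_near. Qed.

(** * Emerging dominance *)

Theorem theorem2 (R : realType) (Xi : pointedMetricType R)
    (mu : probability (borel Xi) R)
    (S : choiceType) (X T : nat -> {fset S}) (x0 : S)
    (Q : forall N : nat, Xi -> 'M[R]_#|{: X N}|)
    (d : nat -> Xi -> measure_display)
    (Omega : forall (N : nat) (theta : Xi), measurableType (d N theta))
    (P : forall (N : nat) (theta : Xi), probability (Omega N theta) R)
    (Y : forall (N : nat) (theta : Xi), nat -> Omega N theta -> X N)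
    (m : nat -> Xi -> R) (h : Xi -> R) (theta_star : Xi)
    (Xi_compact : compact [set: Xi])
    (X_incr : forall N, (1 <= N)%N -> (X N `<=` X N.+1)%fset)
    (x0_in : x0 \in X 1%N)
    (T_sub : forall N, (1 <= N)%N -> (T N `<=` X N)%fset)
    (x0_notin : forall N, (1 <= N)%N -> x0 \notin T N)
    (Q_stochastic : forall N theta, (1 <= N)%N -> stochastic_matrix (Q N theta))
    (Q_irreducible : forall N theta, (1 <= N)%N -> irreducible_matrix (Q N theta))
    (Y_chain : forall N theta, (1 <= N)%N ->
      is_markov_chain (P N theta) x0 (Q N theta) (Y N theta))
    (m_def : forall N theta, (1 <= N)%N ->
      (m N theta)%:E = expected_hitting_time (P N theta) (T N) (Y N theta))
    (m_continuous : forall N, (1 <= N)%N -> continuous (m N))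
    (h_uniform :
      {uniform, (fun N theta => N%:R^-1 * ln (m N theta)) @ \oo --> h})
    (theta_star_supp : supp mu theta_star)
    (theta_star_argmax : argmax h = [set theta_star])
    (h_pos : 0 < h theta_star)
    (supp_neq : supp mu <> [set theta_star]) :
  emerging_dominance mu m (fun _ : 'I_1 => theta_star) (fun _ : 'I_1 => 1).
Proof.
have m1 N : (1 <= N)%N -> forall t, 1 <= m N t.
  move=> N1 t; rewrite -lee_fin m_def//.
  exact: expected_hitting_time_ge1 (Y_chain N t N1) (x0_notin N N1).
have m0 N : (1 <= N)%N -> forall t, 0 < m N t.
  by move=> N1 t; exact: lt_le_trans (m1 N N1 t).
have mint N : (1 <= N)%N -> (0 < \int[mu]_t (m N t)%:E < +oo)%E.
  move=> N1; apply/andP; split; last first.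
    apply: continuous_integral_lty (m_continuous N N1) _ => // t.
    by rewrite ltW// m0.
  apply: (lt_le_trans (@lte01 R)).
  rewrite -(probability_setT mu); apply: measure_le_integral => //.
  - by move=> t; rewrite lee_fin ltW// m0.
  - by move=> t _; rewrite lee_fin m1.
(* [m 0] is unconstrained, so [Phat] may fail to be a probability at index 0: the
   limit is taken along the shifted sequence. *)
have /choice[p pE] : forall N, exists q : probability (borel Xi) R,
    Phat mu (m N.+1) = q :> (set (borel Xi) -> \bar R).
  move=> N; apply: Phat_probability; last exact: mint.
    exact: m_continuous.
  by move=> t; rewrite ltW// m0.
split=> //.
- by move=> i j _; rewrite !ord1.
- split; first by move=> _ [_ _ <-].
  move=> sub; apply: supp_neq.
  by apply/seteqP; split=> [t /sub[_ _ <-]|_ ->].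
- by rewrite big_ord1.
have -> : dirac_mixture (fun _ : 'I_1 => theta_star) (fun _ : 'I_1 => 1) =
    (\d_(theta_star : borel Xi) : set (borel Xi) -> \bar R).
  by apply/funext => A; rewrite /dirac_mixture big_ord1 mul1e.
move=> f cf bf; rewrite -cvg_shiftS /=.
under eq_fun do rewrite pE.
apply: weak_cvg_dirac => // U oU Ux.
under eq_fun do rewrite -pE.
have := Phat_concentrates Xi_compact m_continuous m0 h_uniform theta_star_supp
  theta_star_argmax oU Ux.
by rewrite -cvg_shiftS.
Qed.
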